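(* Let the integers $a^*(n)$ and $c^*(n)$, $n\ge1$, be defined by $$\sum_{n=1}^\infty a^*(n)q^n=q\prod_{n=1}^\infty(1-q^{3n})^8,\qquad \sum_{n=1}^\infty c^*(n)q^n=q\prod_{n=1}^\infty(1-q^{3n})^2(1-q^{9n})^2 .$$ If $p\equiv 1\pmod 3$ is prime, then $c^*(p)$ divides $a^*(p)$.
   Context: The two series are the normalizations $\sum_{n\ge0}a(n)q^{3n+1}$ and $\sum_{n\ge0}c(n)q^{3n+1}$ of $\sum_{n\ge0}a(n)x^n=\prod_{n\ge1}(1-x^n)^8$ and $\sum_{n\ge0}c(n)x^n=\prod_{n\ge1}(1-x^n)^2(1-x^{3n})^2$. Equivalently they are the modular forms $\eta(3z)^8$ and $\eta(3z)^2\eta(9z)^2$, where $\eta(z)=q^{1/24}\prod_{n\ge1}(1-q^n)$ and $q=e^{2\pi i z}$. *)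

(* Defs.v *)
From mathcomp Require Import all_boot all_order all_algebra.

Set Implicit Arguments.
Unset Strict Implicit.
Unset Printing Implicit Defensive.

Import GRing.Theory.
Local Open Scope ring_scope.

(* The formal power series \sum_n f n q^n in Z[[q]], given by its coefficients,
   is the q-adic limit of the polynomials P 0, P 1, ...; a formal infinite
   product is the q-adic limit of its finite partial products. *)
Definition qadic_limit (P : nat -> {poly int}) (f : nat -> int) : Prop :=
  forall n : nat, exists N : nat,
    forall M : nat, (N <= M)%N -> (P M)`_n = f n.

(* q \prod_(n >= 1) (1 - q^(3n))^8 = \sum_n a n q^n *)
Definition is_astar (a : nat -> int) : Prop :=
  qadic_limit
    (fun M => 'X * \prod_(1 <= n < M.+1) (1 - 'X^(3 * n)) ^+ 8) a.

(* q \prod_(n >= 1) (1 - q^(3n))^2 (1 - q^(9n))^2 = \sum_n c n q^n *)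
Definition is_cstar (c : nat -> int) : Prop :=
  qadic_limit
    (fun M => 'X * \prod_(1 <= n < M.+1)
                     ((1 - 'X^(3 * n)) ^+ 2 * (1 - 'X^(9 * n)) ^+ 2)) c.

(* Both infinite products converge, so the two series exist and are unique. *)

Lemma qadic_limit_unique (P : nat -> {poly int}) (f g : nat -> int) :
  qadic_limit P f -> qadic_limit P g -> f =1 g.
Proof.
move=> Pf Pg n; have [N HN] := Pf n; have [K HK] := Pg n.
by rewrite -(HN (maxn N K)) ?leq_maxl // HK // leq_maxr.
Qed.

Lemma qadic_limit_prod (F : nat -> {poly int}) :
  (forall n, exists G, F n = 1 + 'X^n * G) ->
  exists f, qadic_limit (fun M => 'X * \prod_(1 <= n < M.+1) F n) f.
Proof.
move=> HF; exists (fun m => ('X * \prod_(1 <= n < m.+1) F n)`_m) => m.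
exists m; elim=> [|M IHM]; first by rewrite leqn0 => /eqP ->.
rewrite leq_eqVlt => /orP[/eqP -> //|ltmM].
rewrite -IHM // big_nat_recr //=; have [G ->] := HF M.+1.
rewrite mulrDr mulr1 mulrDr coefD (mulrCA _ 'X^_) (mulrCA 'X 'X^_).
by rewrite coefXnM ltmM addr0.
Qed.

Lemma one_plus_XnM n (A B : {poly int}) :
  (exists G, A = 1 + 'X^n * G) -> (exists G, B = 1 + 'X^n * G) ->
  exists G, A * B = 1 + 'X^n * G.
Proof.
move=> [G ->] [H ->]; exists (G + H + G * ('X^n * H)).
by rewrite mulrDl mul1r mulrDr mulr1 !mulrDr !addrA -!mulrA
           (addrAC 1 ('X^n * H)).
Qed.

Lemma one_plus_XnX n (A : {poly int}) k :
  (exists G, A = 1 + 'X^n * G) -> exists G, A ^+ k = 1 + 'X^n * G.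
Proof.
move=> HA; elim: k => [|k IH]; first by exists 0; rewrite mulr0 addr0.
by rewrite exprS; apply: one_plus_XnM.
Qed.

Lemma one_minus_Xmul n k :
  exists G : {poly int}, 1 - 'X^(k.+1 * n) = 1 + 'X^n * G.
Proof. by exists (- 'X^(k * n)); rewrite mulSn exprD mulrN. Qed.

Lemma astar_exists : exists a, is_astar a.
Proof.
by apply: qadic_limit_prod => n; apply: one_plus_XnX; apply: one_minus_Xmul.
Qed.

Lemma cstar_exists : exists c, is_cstar c.
Proof.
apply: qadic_limit_prod => n.
by apply: one_plus_XnM; apply: one_plus_XnX; apply: one_minus_Xmul.
Qed.

(* Main.v *)
Require Import Defs.
From mathcomp Require Import all_boot all_order all_algebra.
From mathcomp Require Import boolp classical_sets functions cardinality fsbigop.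
From mathcomp Require Import zify ring.
Set Implicit Arguments.
Unset Strict Implicit.
Unset Printing Implicit Defensive.
Import Order.TTheory GRing.Theory Num.Theory.
Local Open Scope ring_scope.

(** Write (q) for the product of the 1 - q^n.  The coefficients of both series are
    sums over representations by the norm form N(a, b) = a^2 - a b + b^2:
      (q)^8         = sum of a^2 b q^((N - 1) / 3)   over a + b = 2 mod 3,
      (q)^2 (q^3)^2 = sum of (a - b) q^((N - 1) / 3) over a = 0, b = 2 mod 3.
    For the first, cube Jacobi's series (q)^3 = - sum (-1)^k k q^(k (k - 1) / 2),
    replace the weight - 2 i j k by (i - k)^2 (j - k) and sum over the diagonal
    direction (1, 1, 1): this leaves Euler's pentagonal series, that is (q).
    For the second, sum q^(k (k - 1) / 2 + m^2 + m n + n^2 + m + n) with sign (-1)^k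
    and a weight on l = k + m - n.  With l fixed, the exponent is diagonal in
    (m, n), which gives (q)^2 times a Jacobi series in q^3; with (m, n) fixed, the
    sum over k gives (q^3).  Symmetries of the exponent relate the two weights.
    For a prime p, the pairs with N = p, a = 0 and b = 2 mod 3 are at most the two
    pairs (a, b) and (- a, b - a).  Hence, summing also over rotations by cube roots
    of unity for the first series, c*(p) = a - 2 b and
    a*(p) = - (a + b) (2 a - b) (a - 2 b).

    Everything is computed in q = X^6, so that all exponents are integral
    polynomials in the summation indices. *)

(** * Generating series indexed by a set with an exponent function *)

(** Congruence modulo X^N: it lets long enough finite products stand for the infinite ones. *)
Definition eqm N (A B : {poly int}) := forall i, (i < N)%N -> A`_i = B`_i.

Lemma eqm_sym N A B : eqm N A B -> eqm N B A.
Proof. by move=> AB i iN; rewrite AB. Qed.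

Lemma eqmM N A B A' B' : eqm N A B -> eqm N A' B' -> eqm N (A * A') (B * B').
Proof.
move=> AB AB' i iN; rewrite !coefM; apply: eq_bigr => j _.
by rewrite AB ?AB' //; have := ltn_ord j; lia.
Qed.

Lemma eqmX N A B k : eqm N A B -> eqm N (A ^+ k) (B ^+ k).
Proof. by move=> AB; elim: k => // k IH; rewrite !exprS; apply: eqmM. Qed.

Lemma eqmN N A B : eqm N A B -> eqm N (- A) (- B).
Proof. by move=> AB i iN; rewrite !coefN AB. Qed.

(** A series with constant term 1 is invertible. This is how an auxiliary Euler product is cancelled
    at the end of each series identity. *)
Lemma eqmI N (P A B : {poly int}) :
  P`_0 = 1 -> eqm N (P * A) (P * B) -> eqm N A B.
Proof.
move=> P1 PAB i; have [n] := ubnP i; elim: n i => // n IH i lin iN.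
have := PAB i iN; rewrite !coefM !big_ord_recl /= subn0 P1 !mul1r.
rewrite (eq_bigr (fun j : 'I_i => P`_(bump 0 j) * B`_(i - bump 0 j))).
  exact: addIr.
by move=> j _; rewrite IH // /bump /=; have := ltn_ord j; lia.
Qed.

Section Ser.
Variable I : choiceType.
Implicit Types (E w : I -> int).

(* The coefficient of X^n in the formal sum of w i X^(E i).  It is 0 by convention
   when infinitely many of its terms are nonzero; admissible E excludes this. *)
Definition ser E w (n : nat) : int :=
  \sum_(i \in [set i | E i = n%:Z]%classic) w i.

Definition admissible E :=
  (forall i, 0 <= E i) /\
  forall n : nat, finite_set [set i | E i <= n%:Z]%classic.

Lemma ser_fset E w (n : nat) (r : seq I) : uniq r ->
  (forall i, E i = n%:Z -> i \in r) -> ser E w n = \sum_(i <- r | E i == n%:Z) w i.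
Proof.
move=> ur Er; rewrite bigfs //; last by move=> i /eqP /Er ->.
by apply: eq_fsbigl; rewrite eqEsubset; split=> i /= /eqP.
Qed.

Lemma admissible_seq E (n : nat) : admissible E ->
  exists2 r : seq I, uniq r & forall i, E i <= n%:Z -> i \in r.
Proof.
move=> [_ /(_ n)/finite_seqP [r Er]]; exists (undup r); first exact: undup_uniq.
move=> i Ei; rewrite mem_undup.
by have : [set i | E i <= n%:Z]%classic i by []; rewrite Er.
Qed.

Lemma eq_ser E w w' n : w =1 w' -> ser E w n = ser E w' n.
Proof. by move=> /funext ->. Qed.

Lemma serD E w w' n : admissible E ->
  ser E (fun i => w i + w' i) n = ser E w n + ser E w' n.
Proof.
move=> /(admissible_seq n)[r ur Er].
by rewrite !(ser_fset _ ur) ?big_split // => i Ei; apply: Er; rewrite Ei.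
Qed.

Lemma serZ E w c n : admissible E ->
  ser E (fun i => c * w i) n = c * ser E w n.
Proof.
move=> /(admissible_seq n)[r ur Er].
by rewrite !(ser_fset _ ur) ?big_distrr // => i Ei; apply: Er; rewrite Ei.
Qed.

Lemma serN E w n : admissible E -> ser E (fun i => - w i) n = - ser E w n.
Proof.
by move=> aE; rewrite -mulN1r -serZ //; apply: eq_ser => i; rewrite mulN1r.
Qed.

End Ser.

(** [h] has to reach only the indices of nonzero weight, so a sum confined to a residue class can be
    rewritten over a parametrization of that class. *)
Lemma ser_reindex (I J : choiceType) (h : J -> I) E w E' w' n :
  admissible E -> injective h -> (forall j, E (h j) = E' j) ->
  (forall j, w (h j) = w' j) ->
  (forall i, w i != 0 -> exists j, i = h j) -> ser E w n = ser E' w' n.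
Proof.
move=> aE hinj hE hw hsur; rewrite /ser.
under [RHS]eq_fsbigr => j _ do rewrite -hw.
rewrite -(@fsbig_image _ _ _ _ _ [set j | E' j = n%:Z]%classic h w); last by move=> x y _ _ /hinj.
symmetry; apply: fsbig_widen.
  by move=> _ /= [j Ej <-]; rewrite hE.
move=> i /= [Ei nh]; apply/eqP; apply: contraPT nh => /hsur[j ij].
by move=> nh; apply: nh; exists j => //; rewrite -hE -ij.
Qed.

Lemma ser_bij (I : choiceType) (h h' : I -> I) (E w w' : I -> int) n :
  admissible E -> cancel h h' -> cancel h' h -> (forall j, E (h j) = E j) ->
  (forall j, w (h j) = w' j) -> ser E w n = ser E w' n.
Proof.
move=> aE hK h'K hE hw; apply: (ser_reindex n aE (can_inj hK) hE hw).
by move=> i _; exists (h' i).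
Qed.

Lemma ser_anti (I : choiceType) (h : I -> I) (E w : I -> int) n :
  admissible E -> involutive h -> (forall j, E (h j) = E j) ->
  (forall j, w (h j) = - w j) -> ser E w n = 0.
Proof.
move=> aE hK hE hw; have := ser_bij n aE hK hK hE hw; rewrite serN //; lia.
Qed.

Lemma admissibleD (I J : choiceType) (E : I -> int) (F : J -> int) :
  admissible E -> admissible F -> admissible (fun x : I * J => E x.1 + F x.2).
Proof.
move=> [E0 fE] [F0 fF]; split=> [x|n]; first exact: addr_ge0.
apply: sub_finite_set (finite_setX (fE n) (fF n)).
move=> [i j] /= EF; have := E0 i; have := F0 j; split=> /=; lia.
Qed.

Lemma serM (I J : choiceType) (E w : I -> int) (F v : J -> int) n :
  admissible E -> admissible F ->
  \sum_(k < n.+1) ser E w k * ser F v (n - k) =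
  ser (fun x : I * J => E x.1 + F x.2) (fun x => w x.1 * v x.2) n.
Proof.
move=> aE aF; have [r ur Er] := admissible_seq n aE.
have [s us Fs] := admissible_seq n aF.
have E0 := aE.1; have F0 := aF.1.
rewrite (@ser_fset _ _ _ n [seq (x, y) | x <- r, y <- s]); last 2 first.
- by apply: allpairs_uniq => // -[? ?] [? ?].
- move=> [i j] /= EF; apply: allpairs_f; [apply: Er|apply: Fs].
    by have := F0 j; lia.
  by have := E0 i; lia.
rewrite [RHS]big_mkcond big_allpairs /=.
under eq_bigr => k _.
  rewrite (ser_fset _ ur); last by move=> i Ei; apply: Er; rewrite Ei; have := ltn_ord k; lia.
  rewrite (ser_fset _ us); last by move=> i Ei; apply: Fs; rewrite Ei; lia.
  rewrite big_distrlr /= big_mkcond.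
  under eq_bigr => i _ do rewrite big_mkcond /=.
  over.
rewrite exchange_big /=; apply: eq_bigr => i _.
transitivity (\sum_(k < n.+1) \sum_(j <- s)
   if (E i == k%:Z) && (F j == (n - k)%N%:Z) then w i * v j else 0).
  apply: eq_bigr => k _; case: eqP => //= _.
  by rewrite big1.
rewrite exchange_big /=; apply: eq_bigr => j _.
case: eqP => [EF|EF]; last first.
  apply: big1 => k _; case: ifP => // /andP[/eqP Ek /eqP Fk].
  by case: EF; rewrite Ek Fk; have := ltn_ord k; lia.
have Ei : (`|E i| < n.+1)%N by have := E0 i; have := F0 j; lia.
rewrite (bigD1 (Ordinal Ei)) //= ifT; last by have := E0 i; have := F0 j; lia.
rewrite big1 ?addr0 // => k /eqP kE; case: ifP => // /andP[/eqP Ek _].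
by case: kE; apply: val_inj => /=; rewrite Ek.
Qed.

Definition gf (I : choiceType) N (A : {poly int}) (E w : I -> int) :=
  admissible E /\ forall n, (n < N)%N -> A`_n = ser E w n.

Lemma gfM (I J : choiceType) N A B (E w : I -> int) (F v : J -> int) :
  gf N A E w -> gf N B F v ->
  gf N (A * B) (fun x : I * J => E x.1 + F x.2) (fun x => w x.1 * v x.2).
Proof.
move=> [aE wE] [aF vF]; split; first exact: admissibleD.
move=> n nN; rewrite -serM // coefM; apply: eq_bigr => k _.
by rewrite wE ?vF //; have := ltn_ord k; lia.
Qed.

Lemma gfN (I : choiceType) N A (E w : I -> int) :
  gf N A E w -> gf N (- A) E (fun i => - w i).
Proof. by move=> [aE wE]; split=> // n nN; rewrite coefN serN ?wE. Qed.

Lemma gf_eqm (I : choiceType) N A B (E w : I -> int) :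
  eqm N A B -> gf N A E w -> gf N B E w.
Proof. by move=> AB [aE wE]; split=> // n nN; rewrite -AB ?wE. Qed.

Lemma gf_ser (I : choiceType) N (E w : I -> int) :
  admissible E -> gf N (\poly_(n < N) ser E w n) E w.
Proof. by move=> aE; split=> // n nN; rewrite coef_poly nN. Qed.

Lemma eqm_gf (I J : choiceType) N A B (E w : I -> int) (F v : J -> int) :
  gf N A E w -> gf N B F v -> (forall n, ser E w n = ser F v n) -> eqm N A B.
Proof. by move=> [_ wE] [_ vF] EF n nN; rewrite wE ?vF. Qed.

Lemma finite_int_itv (a b : int) : finite_set [set k : int | a <= k <= b]%classic.
Proof.
apply: (@sub_finite_set _ _ (@image nat int `I_(`|b - a|%N.+1) (fun n => n%:Z + a))%classic).
  by move=> k /= kab; exists `|k - a|%N => /=; lia.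
exact: finite_image (finite_II _).
Qed.

(** The cases k = 0 and k = 2 are the exponents of Jacobi's and of Euler's series. *)
Lemma admissible_quadr (c k : int) :
  0 < c -> 0 <= k -> admissible (fun x : int => c * ((k + 1) * x ^+ 2 - x)).
Proof.
move=> c0 k0; pose f (x : int) := (k + 1) * x ^+ 2 - x.
have f_ge x : `|x| - 1 <= f x /\ 0 <= f x.
  have -> : f x = k * x ^+ 2 + (x ^+ 2 - x) by rewrite /f; ring.
  have x2 : `|x| - 1 <= x ^+ 2 - x /\ 0 <= x ^+ 2 - x by rewrite expr2; split; nia.
  by have := mulr_ge0 k0 (sqr_ge0 x); lia.
have cf x : f x <= c * f x by rewrite ler_peMl //; case: (f_ge x).
split=> [x|n]; first by apply: mulr_ge0; [exact: ltW | case: (f_ge x)].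
apply: sub_finite_set (finite_int_itv (- n%:Z - 1) (n%:Z + 1)) => x /= Ex.
by have [] := f_ge x; have := le_trans (cf x) Ex; lia.
Qed.

(** * Jacobi's and Euler's series from the q-binomial theorem *)

Section QBinomial.
Variable R : comNzRingType.
Implicit Types q x y : R.

(** The Gaussian binomial coefficient, by Pascal's rule, so that no division is involved. *)
Fixpoint qbin q (m k : nat) : R :=
  match m, k with
  | _, 0%N => 1
  | 0%N, _.+1 => 0
  | m'.+1, k'.+1 => qbin q m' k' + q ^+ k * qbin q m' k
  end.

Definition qfac q n := \prod_(i < n) (1 - q ^+ i.+1).

Lemma qbin0 q m : qbin q m 0 = 1. Proof. by case: m. Qed.

Lemma qbin_small q m k : (m < k)%N -> qbin q m k = 0.
Proof.
elim: m k => [|m IH] [|k] //= mk.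
by rewrite !IH ?mulr0 ?addr0 //; lia.
Qed.

Lemma qfacS q n : qfac q n.+1 = qfac q n * (1 - q ^+ n.+1).
Proof. by rewrite /qfac big_ord_recr. Qed.

Lemma qbin_fac q m k : (k <= m)%N ->
  qbin q m k * qfac q k * qfac q (m - k) = qfac q m.
Proof.
have f0 : qfac q 0 = 1 by rewrite /qfac big_ord0.
elim: m k => [|m IH] [|k] //= km; rewrite ?f0 ?mul1r ?subn0 //.
rewrite subSS mulrDl mulrDl.
have -> : qbin q m k * qfac q k.+1 * qfac q (m - k) = qfac q m * (1 - q ^+ k.+1).
  by rewrite qfacS -(IH k) //; ring.
have [km'|mk] := ltnP k m; last first.
  have -> : k = m by lia.
  by rewrite qbin_small // qfacS !(mulr0, mul0r, addr0).
have -> : q ^+ k.+1 * qbin q m k.+1 * qfac q k.+1 * qfac q (m - k)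
   = qfac q m * (q ^+ k.+1 * (1 - q ^+ (m - k))).
  have -> : (m - k = (m - k.+1).+1)%N by lia.
  by rewrite [qfac q (m - k.+1).+1]qfacS -(IH k.+1) //; ring.
rewrite qfacS -mulrDr; congr (_ * _).
rewrite mulrBr mulr1 -exprD; have -> : (k.+1 + (m - k) = m.+1)%N by lia.
by ring.
Qed.

(** Induction on m: splitting off the factor i = 0 replaces y by y q in the others. *)
Lemma qbin_theorem q x y m :
  \prod_(i < m) (x + y * q ^+ i) =
  \sum_(k < m.+1) q ^+ 'C(k, 2) * qbin q m k * x ^+ (m - k) * y ^+ k.
Proof.
elim: m y => [|m IH] y.
  by rewrite big_ord0 big_ord_recl big_ord0 /= bin0n /= !expr0; ring.
rewrite big_ord_recl /= expr0 mulr1.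
under eq_bigr => i _ do rewrite /bump /= exprD expr1 mulrA.
rewrite IH mulrDl addrC.
set S := \sum_(i < m.+1) _; rewrite [RHS]big_ord_recl /=.
under [in RHS]eq_bigr => i _ do
  rewrite /bump /= add1n subSS binS bin1 mulrDr mulrDl mulrDl.
rewrite big_split /= addrCA; congr (_ + _).
  rewrite /S mulr_sumr; apply: eq_bigr => i _.
  by rewrite exprMn exprD !exprS; ring.
rewrite big_ord_recr /= qbin_small // !(mulr0, mul0r, addr0).
rewrite /S big_ord_recl mulrDr mulr_sumr /= ?qbin0 !subn0 /= exprS; congr (_ + _).
  by rewrite !mulr1 mulrCA.
apply: eq_bigr => i _; rewrite /bump /= add1n.
have -> : (m - i = (m - i.+1).+1)%N by have := ltn_ord i; lia.
by rewrite !binS bin1 exprMn !exprD !exprS; ring.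
Qed.

End QBinomial.

Lemma map_qbin (R S : comNzRingType) (f : {rmorphism R -> S}) q m k :
  f (qbin q m k) = qbin (f q) m k.
Proof.
by elim: m k => [|m IH] [|k]; rewrite /= ?rmorph0 ?rmorph1 // rmorphD rmorphM rmorphXn !IH.
Qed.

Lemma bin2Z (k : nat) : 2 * 'C(k, 2)%:Z = k%:Z * (k%:Z - 1).
Proof. by elim: k => [|k IH] //; rewrite binS bin1; lia. Qed.

Lemma eqm_qfac_add N d n t : (0 < d)%N -> (N <= n.+1)%N ->
  eqm N (qfac 'X^d (n + t)) (qfac 'X^d n).
Proof.
move=> d0 Nn; elim: t => [|t IH]; first by rewrite addn0.
rewrite addnS qfacS -[qfac _ n]mulr1; apply: eqmM => // i iN.
rewrite coefB -exprM coefXn; have -> : (i == d * (n + t).+1)%N = false by nia.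
by rewrite subr0.
Qed.

Lemma eqm_qfac N d n m : (0 < d)%N -> (N <= n.+1)%N -> (N <= m.+1)%N ->
  eqm N (qfac 'X^d n) (qfac 'X^d m).
Proof.
move=> d0 Nn Nm; have [nm|/ltnW nm] := leqP n m.
  by rewrite -(subnKC nm); apply: eqm_sym; apply: eqm_qfac_add.
by rewrite -(subnKC nm); apply: eqm_qfac_add.
Qed.

Lemma coef0_qfac d n : (0 < d)%N -> (qfac ('X^d : {poly int}) n)`_0 = 1.
Proof.
move=> d0; rewrite -(@eqm_qfac 1 d 0 n) //.
by rewrite /qfac big_ord0 coef1.
Qed.

(** Far from both ends the Gaussian binomial coefficient tends to the inverse of the Euler
    product. *)
Lemma eqm_qfac_qbin N d n m k : (0 < d)%N -> (k <= m)%N ->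
  (N <= n.+1)%N -> (N <= k.+1)%N -> (N <= (m - k).+1)%N ->
  eqm N (qfac 'X^d n * qbin 'X^d m k) 1.
Proof.
move=> d0 km Nn Nk Nmk.
apply: (@eqmI N (qfac 'X^d k * qfac 'X^d (m - k))).
  by rewrite coefM big_ord1 subn0 !coef0_qfac ?mulr1.
have -> : qfac 'X^d k * qfac 'X^d (m - k) * (qfac 'X^d n * qbin 'X^d m k)
   = qfac 'X^d n * qfac ('X^d : {poly int}) m by rewrite -(qbin_fac _ km); ring.
by rewrite mulr1; apply: eqmM; apply: eqm_qfac => //; lia.
Qed.

Definition zsign (k : int) : int := if (2 %| k)%Z then 1 else -1.

Lemma zsignD j k : zsign (j + k) = zsign j * zsign k.
Proof. by rewrite /zsign; case: ifP; case: ifP; case: ifP; lia. Qed.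

Lemma zsignN k : zsign (- k) = zsign k.
Proof. by rewrite /zsign; case: ifP; case: ifP; lia. Qed.

Lemma zsign_nat (k : nat) : zsign k = (-1) ^+ k.
Proof.
rewrite -signr_odd /zsign; case: ifP; case: (boolP (odd k)); rewrite ?expr0 ?expr1 //; lia.
Qed.

(** Passage from a finite identity to a series: j = k - n runs over a window containing every index
    of exponent below N, and each cofactor [U k] need only be 1 to the precision left over by its
    power of X. *)
Lemma gf_window N n m (A : {poly int}) (E w : int -> int) (U : nat -> {poly int}) :
  admissible E ->
  A = \sum_(k < m) w (k%:Z - n%:Z) *: ('X^(absz (E (k%:Z - n%:Z)%R)) * U k) ->
  (forall k, (k < m)%N -> eqm (N - absz (E (k%:Z - n%:Z)%R)) (U k) 1) ->
  (forall j : int, E j < N%:Z -> - n%:Z <= j < m%:Z - n%:Z) ->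
  gf N A E w.
Proof.
move=> aE AE U1 EN; have E0 := aE.1; split=> // i iN.
rewrite (@ser_fset _ _ _ _ [seq (k%:Z - n%:Z : int) | k <- iota 0 m]); last 2 first.
- by rewrite map_inj_uniq ?iota_uniq // => x y; lia.
- move=> j Ej; have jn : - n%:Z <= j < m%:Z - n%:Z by apply: EN; lia.
  by apply/mapP; exists (absz (j + n%:Z)%R); rewrite ?mem_iota; lia.
rewrite AE coef_sum big_map -[in RHS](subn0 m) -/(index_iota _ _) big_mkord.
rewrite [RHS]big_mkcond; apply: eq_bigr => k _.
rewrite coefZ coefXnM; have Ek := E0 (k%:Z - n%:Z).
case: ltnP => [iE|Ei]; first by rewrite mulr0; case: eqP => //; lia.
rewrite U1 //; last by lia.
rewrite coef1; case: eqP => [iE|iE]; first by rewrite ifT ?mulr1 //; lia.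
by rewrite ifF ?mulr0 //; lia.
Qed.

Lemma prod_sub_exp (R : comNzRingType) (z : R) n (d : nat) (F : nat -> nat) :
  (forall i, (i < n)%N -> (F i <= d)%N) ->
  \prod_(i < n) (z ^+ d - z ^+ (F i)) =
  (-1) ^+ n * z ^+ (\sum_(i < n) F i)%N * \prod_(i < n) (1 - z ^+ (d - F i)).
Proof.
elim: n => [|n IH] FdF; first by rewrite !big_ord0 !mulr1.
rewrite !big_ord_recr /= IH; last by move=> i ni; apply: FdF; lia.
have -> : z ^+ d = z ^+ (F n) * z ^+ (d - F n) by rewrite -exprD subnKC ?FdF.
by rewrite exprS exprD; ring.
Qed.

Lemma jacobi_exponent (d n k : nat) : (k <= (2 * n).+1)%N ->
  (2 * d * ('C(k, 2) + n * ((2 * n).+1 - k)) =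
   2 * d * (n + 'C(n, 2) + n * n)
   + absz (d%:Z * ((k%:Z - n%:Z) ^+ 2 - (k%:Z - n%:Z))%R)%R)%N.
Proof.
move=> km; set e := (d%:Z * _).
have e0 : 0 <= e by apply: mulr_ge0 => //; rewrite expr2; nia.
apply/eqP; rewrite -eqz_nat PoszD abszE (ger0_norm e0) !(PoszM, PoszD) -subzn //.
apply/eqP; transitivity (d%:Z * (2 * 'C(k, 2)%:Z) + 2 * d%:Z * n%:Z * ((2 * n).+1%:Z - k%:Z)).
  by ring.
transitivity (d%:Z * (2 * n%:Z + 2 * 'C(n, 2)%:Z + 2 * n%:Z * n%:Z) + e); last by ring.
by rewrite !bin2Z /e; ring.
Qed.

(* The q-binomial theorem for x = z^n, y = - Y and m = 2 n + 1 has the factor 1 - Y;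
   its derivative at Y = 1 is the identity. *)
Lemma jacobi_finite (d n : nat) :
  \sum_(k < (2 * n).+2) (zsign (k%:Z - n%:Z) * (k%:Z - n%:Z)) *:
     ('X^(absz (d%:Z * ((k%:Z - n%:Z) ^+ 2 - (k%:Z - n%:Z)))) *
      qbin 'X^(2 * d) (2 * n).+1 k)
  = - qfac ('X^(2 * d) : {poly int}) n ^+ 2.
Proof.
pose z : {poly int} := 'X^(2 * d); pose m := (2 * n).+1.
pose P : {poly {poly int}} := \prod_(i < m) ((z ^+ n)%:P + (- 'X) * (z ^+ i)%:P).
pose C k : {poly int} := (-1) ^+ k * (z ^+ ('C(k, 2) + n * (m - k)) * qbin z m k).
have PE : P = \sum_(k < m.+1) C k *: 'X^k.
  have := @qbin_theorem {poly {poly int}} z%:P (z ^+ n)%:P (- 'X) m.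
  under eq_bigr => i _ do rewrite -rmorphXn.
  rewrite -/P => ->; apply: eq_bigr => k _.
  rewrite -[X in qbin X]/(polyC z) -(map_qbin polyC) -mul_polyC /C.
  rewrite [(- 'X) ^+ _]exprNn exprD exprM !rmorphM /= !rmorphXn /= rmorphN1; ring.
(* The factor i = n is z^n (1 - X); [G] collects this z^n and all other factors. *)
pose G : {poly {poly int}} := \prod_(i < n) ((z ^+ n)%:P - 'X * (z ^+ i)%:P) *
   ((z ^+ n)%:P * \prod_(i < n) ((z ^+ n)%:P - 'X * (z ^+ (n + i.+1))%:P)).
have PG : P = (1 - 'X) * G.
  rewrite /P /m (_ : (2 * n).+1 = (n + n.+1)%N); last by lia.
  rewrite big_split_ord big_ord_recl /= /G addn0.
  under eq_bigr => i _ do rewrite mulNr.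
  under [X in _ * (_ * X)]eq_bigr => i _ do rewrite mulNr.
  by ring.
have h1 : (1 - 'X : {poly {poly int}}).[1] = 0 by rewrite !hornerE subrr.
  have S0 : \sum_(k < m.+1) C k = 0.
  have : P.[1] = 0 by rewrite PG hornerM h1 mul0r.
  by rewrite PE horner_sum => {2}<-; apply: eq_bigr => k _; rewrite hornerZ hornerXn expr1n mulr1.
have S1 : \sum_(k < m.+1) k%:R * C k = - G.[1].
  have : P^`().[1] = - G.[1].
    by rewrite PG derivM derivB derivX derivC hornerD !hornerM h1 mul0r addr0 sub0r hornerN hornerC mulN1r.
  rewrite PE (raddf_sum (@deriv _)) horner_sum => <-; apply: eq_bigr => k _ /=.
  by rewrite derivZ derivXn hornerZ hornerMn hornerXn expr1n mulrC.
(* At 1, the n factors before i = n and the n factors after it each give [qfac z n], up to sign and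
   powers of z. *)
have GE : G.[1] = (-1) ^+ n * z ^+ (n + 'C(n, 2) + n * n) * qfac z n ^+ 2.
  rewrite /G !hornerM !horner_prod hornerC.
  under eq_bigr => i _ do rewrite hornerD hornerN hornerM hornerX !hornerC mul1r.
  under [X in _ * (_ * X)]eq_bigr => i _ do
    rewrite hornerD hornerN hornerM hornerX !hornerC mul1r exprD -{1}[z ^+ n]mulr1 -mulrBr.
  rewrite big_split /= prodr_const card_ord -/(qfac z n).
  have -> : \prod_(i < n) (z ^+ n - z ^+ i) =
      (-1) ^+ n * z ^+ 'C(n, 2) * qfac z n.
    rewrite (@prod_sub_exp _ z n n id); last by move=> i /ltnW.
    rewrite -(big_mkord xpredT id) -bin2_sum /qfac (reindex_inj rev_ord_inj) /=.
    by congr (_ * _); apply: eq_bigr => i _; rewrite subKn.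
  by rewrite !exprD exprM; ring.
apply: (@mulfI _ ((-1) ^+ n * z ^+ (n + 'C(n, 2) + n * n))).
  by rewrite mulf_neq0 ?signr_eq0 // expf_neq0 // -size_poly_gt0 size_polyXn.
(* Since the [C k] sum to 0, the weight k may be centred at n. *)
have S2 : \sum_(k < m.+1) (k%:R - n%:R) * C k = - G.[1].
  under eq_bigr => k _ do rewrite mulrBl.
  by rewrite sumrB -mulr_sumr S0 mulr0 subr0.
rewrite mulrN -GE -S2 mulr_sumr; apply: eq_bigr => k _; rewrite /C -mul_polyC zsignD zsignN !zsign_nat.
have -> : z ^+ ('C(k, 2) + n * (m - k)) = z ^+ (n + 'C(n, 2) + n * n) *
   'X^(absz (d%:Z * ((k%:Z - n%:Z) ^+ 2 - (k%:Z - n%:Z)))).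
  by rewrite /z -!exprM -exprD jacobi_exponent //; have := ltn_ord k; lia.
rewrite -/z -/m; set Y := 'X^_.
have -> : ((-1) ^+ k * (-1) ^+ n * (k%:Z - n%:Z))%:P
   = (-1) ^+ k * (-1) ^+ n * (k%:R - n%:R) :> {poly int}.
  by rewrite !rmorphM /= !rmorphXn /= rmorphN1 rmorphB /= -!natz !rmorph_nat.
have : (-1) ^+ n * (-1) ^+ n = 1 :> {poly int} by rewrite -expr2 sqrr_sign.
set sn := (-1) ^+ n; set sk := (-1) ^+ k => ss.
transitivity (sn * sn * (z ^+ (n + 'C(n, 2) + n * n) * sk * (k%:R - n%:R) * Y * qbin z m k)).
  by ring.
by rewrite ss; ring.
Qed.

(* The base is X^(2 d), so that the triangular numbers k (k - 1) / 2 become the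
   integral exponents d (k^2 - k). *)
Lemma jacobi N M d : (0 < d)%N -> (N <= M)%N ->
  gf N (- qfac 'X^(2 * d) M ^+ 3)
    (fun k : int => d%:Z * (k ^+ 2 - k)) (fun k => zsign k * k).
Proof.
move=> d0 NM.
have aE : admissible (fun k : int => d%:Z * (k ^+ 2 - k)).
  have := @admissible_quadr d%:Z 0; rewrite add0r.
  by under eq_fun => x do rewrite mul1r; apply.
apply: gf_eqm (_ : gf N (- qfac 'X^(2 * d) N ^+ 3) _ _).
  by apply/eqmN/eqmX/eqm_qfac; lia.
pose U k : {poly int} := qfac 'X^(2 * d) N * qbin 'X^(2 * d) (2 * N).+1 k.
apply: (@gf_window N N (2 * N).+2 _ _ _ U aE).
- rewrite exprS -mulrN -jacobi_finite mulr_sumr; apply: eq_bigr => k _.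
  by rewrite /U -scalerAr; congr (_ *: _); rewrite mulrCA.
(* Away from the centre k = N the binomial coefficient is less precise, but the exponent is at least
   |k - N| - 1, which makes up for it. *)
- move=> k km; set e := _ * _.
  have e0 : `|k%:Z - N%:Z| - 1 <= e.
    have x2 : `|k%:Z - N%:Z| - 1 <= (k%:Z - N%:Z) ^+ 2 - (k%:Z - N%:Z) by rewrite expr2; nia.
    have x0 : 0 <= (k%:Z - N%:Z) ^+ 2 - (k%:Z - N%:Z) by rewrite expr2; nia.
    by apply: le_trans x2 _; rewrite /e ler_peMl.
  by apply: eqm_qfac_qbin; lia.
- move=> j jN.
  have x2 : `|j| - 1 <= j ^+ 2 - j by rewrite expr2; nia.
  have x0 : 0 <= j ^+ 2 - j by rewrite expr2; nia.
  have := le_trans x2 (_ : _ <= d%:Z * (j ^+ 2 - j)); rewrite ler_peMl // => /(_ isT).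
  lia.
Qed.

Lemma qfac_split (R : comNzRingType) (z : R) n : qfac z (3 * n) =
  \prod_(i < n) (1 - z ^+ (3 * i).+1) * \prod_(i < n) (1 - z ^+ (3 * i).+2) *
  qfac (z ^+ 3) n.
Proof.
elim: n => [|n IH]; first by rewrite muln0 /qfac !big_ord0 !mulr1.
rewrite (_ : (3 * n.+1 = (3 * n).+3)%N); last by lia.
rewrite !qfacS IH !big_ord_recr /= -exprM (_ : (3 * n.+1 = (3 * n).+3)%N); last by lia.
ring.
Qed.

Lemma euler_exponent (d n k : nat) : (k <= 2 * n)%N ->
  (2 * d * (3 * 'C(k, 2) + 3 * n * (2 * n - k) + k) =
   2 * d * (3 * 'C(n, 2) + n + 3 * n * n)
   + absz (d%:Z * (3 * (k%:Z - n%:Z) ^+ 2 - (k%:Z - n%:Z))%R)%R)%N.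
Proof.
move=> km; set e := (d%:Z * _).
have e0 : 0 <= e by apply: mulr_ge0 => //; rewrite expr2; nia.
apply/eqP; rewrite -eqz_nat PoszD abszE (ger0_norm e0) !(PoszM, PoszD) -subzn //.
apply/eqP; transitivity (d%:Z * (3 * (2 * 'C(k, 2)%:Z)) +
   2 * d%:Z * (3 * n%:Z * ((2 * n)%N%:Z - k%:Z) + k%:Z)); first by ring.
transitivity (d%:Z * (2 * n%:Z + 3 * (2 * 'C(n, 2)%:Z) + 6 * n%:Z * n%:Z) + e); last by ring.
by rewrite !bin2Z /e; ring.
Qed.

(* The q-binomial theorem in base z^3 for x = z^(3 n), y = - z and m = 2 n. *)
Lemma euler_finite (d n : nat) :
  \sum_(k < (2 * n).+1) zsign (k%:Z - n%:Z) *: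
     ('X^(absz (d%:Z * (3 * (k%:Z - n%:Z) ^+ 2 - (k%:Z - n%:Z)))) *
      (qfac ('X^(2 * d) ^+ 3) n * qbin ('X^(2 * d) ^+ 3) (2 * n) k))
  = qfac ('X^(2 * d) : {poly int}) (3 * n).
Proof.
pose z : {poly int} := 'X^(2 * d); rewrite -/z.
have H := @qbin_theorem {poly int} (z ^+ 3) (z ^+ 3 ^+ n) (- z) (2 * n).
have LHS : \prod_(i < 2 * n) (z ^+ 3 ^+ n + - z * z ^+ 3 ^+ i) * qfac (z ^+ 3) n =
  (-1) ^+ n * z ^+ (3 * 'C(n, 2) + n + 3 * n * n) * qfac z (3 * n).
  (* The factors i < n yield, after reversal, the exponents that are 2 mod 3, and the factors i >= n
     those that are 1 mod 3. *)
  rewrite mul2n -addnn big_split_ord /= qfac_split.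
  rewrite (eq_bigr (fun i : 'I_n => z ^+ (3 * n) - z ^+ (3 * i).+1)); last first.
    by move=> i _; rewrite mulNr -!(exprM z) exprS.
  have /= -> := @prod_sub_exp _ z n (3 * n) (fun i => (3 * i).+1);
    last by move=> i; lia.
  rewrite [in X in _ * X * _](eq_bigr (fun i : 'I_n => z ^+ (3 * n) * (1 - z ^+ (3 * i).+1))); last first.
    by move=> i _; rewrite mulNr -!(exprM z) mulrBr mulr1 mulnDr exprD exprS; ring.
  rewrite big_split /= prodr_const card_ord.
  have -> : \prod_(i < n) (1 - z ^+ (3 * n - (3 * i).+1)) = \prod_(i < n) (1 - z ^+ (3 * i).+2).
    rewrite (reindex_inj rev_ord_inj) /=; apply: eq_bigr => i _.
    by congr (1 - z ^+ _); have := ltn_ord i; lia.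
  have -> : (\sum_(i < n) (3 * i).+1 = 3 * 'C(n, 2) + n)%N.
    elim: (n) => [|m IH]; first by rewrite big_ord0.
    by rewrite big_ord_recr /= IH binS bin1; lia.
  rewrite -(exprM z) [z ^+ (_ + _ + _)]exprD; ring.
apply: (@mulfI _ ((-1) ^+ n * z ^+ (3 * 'C(n, 2) + n + 3 * n * n))).
  by rewrite mulf_neq0 ?signr_eq0 // expf_neq0 // -size_poly_gt0 size_polyXn.
rewrite -LHS H mulr_suml mulr_sumr; apply: eq_bigr => k _.
rewrite -mul_polyC zsignD zsignN !zsign_nat.
have E : z ^+ 3 ^+ 'C(k, 2) * z ^+ 3 ^+ n ^+ (2 * n - k) * z ^+ k =
   z ^+ (3 * 'C(n, 2) + n + 3 * n * n) *
   'X^(absz (d%:Z * (3 * (k%:Z - n%:Z) ^+ 2 - (k%:Z - n%:Z)))).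
  rewrite -!(exprM z) -!exprD /z -exprM.
  rewrite euler_exponent; last by have := ltn_ord k; lia.
  by rewrite exprD exprM.
have -> : ((-1) ^+ k * (-1) ^+ n)%:P = (-1) ^+ k * (-1) ^+ n :> {poly int}.
  by rewrite !rmorphM /= !rmorphXn /= rmorphN1.
have : (-1) ^+ n * (-1) ^+ n = 1 :> {poly int} by rewrite -expr2 sqrr_sign.
move: E; set Y := 'X^_; set zK := z ^+ (_ + _ + _).
set sn := (-1) ^+ n; set qb := qbin _ _ _; set qf := qfac _ _ => E ss.
transitivity (sn * sn * ((-1) ^+ k * (zK * Y) * qb * qf)); first by ring.
by rewrite ss -E [(- z) ^+ k]exprNn; ring.
Qed.

Lemma euler N M d : (0 < d)%N -> (N <= M)%N ->
  gf N (qfac 'X^(2 * d) M) (fun k : int => d%:Z * (3 * k ^+ 2 - k)) zsign.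
Proof.
move=> d0 NM.
have aE : admissible (fun k : int => d%:Z * (3 * k ^+ 2 - k)).
  by apply: (@admissible_quadr d%:Z 2).
apply: gf_eqm (_ : gf N (qfac 'X^(2 * d) (3 * N)) _ _).
  by apply/eqm_qfac; lia.
have j_le (j : int) : `|j| <= d%:Z * (3 * j ^+ 2 - j).
  have x2 : `|j| <= 3 * j ^+ 2 - j by rewrite expr2; nia.
  by apply: (le_trans x2); rewrite ler_peMl // (le_trans _ x2).
pose U k : {poly int} := qfac ('X^(2 * d) ^+ 3) N * qbin ('X^(2 * d) ^+ 3) (2 * N) k.
apply: (@gf_window N N (2 * N).+1 _ _ _ U aE).
- by rewrite -euler_finite.
- move=> k km; have := j_le (k%:Z - N%:Z); set e := _ * _ => e0.
  by rewrite /U -exprM; apply: eqm_qfac_qbin; lia.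
- by move=> j jN; have := j_le j; lia.
Qed.

(** * The eighth power *)

(** Off [D] the weight is 0, so extending the involution by the identity keeps the antisymmetry. *)
Lemma ser_anti_on (I : choiceType) (D : pred I) (h : I -> I) (E w : I -> int) n :
  admissible E -> (forall x, D x -> D (h x)) -> (forall x, D x -> h (h x) = x) ->
  (forall x, D x -> E (h x) = E x) -> (forall x, D x -> w (h x) = - w x) ->
  (forall x, ~~ D x -> w x = 0) -> ser E w n = 0.
Proof.
move=> aE hD hK hE hw w0.
apply: (@ser_anti _ (fun x => if D x then h x else x)) => // x.
- by case: (boolP (D x)) => Dx; rewrite ?(negbTE Dx) // hD ?hK.
- by case: ifP => // /hE.
- by case: (boolP (D x)) => [/hw|/w0->].
Qed.

Definition ind3 (r l : int) : int := if (l %% 3)%Z == r then 1 else 0.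

Lemma ind3T r l : (l %% 3)%Z = r -> ind3 r l = 1.
Proof. by rewrite /ind3 => ->; rewrite eqxx. Qed.

Lemma ind3F r l : (l %% 3)%Z != r -> ind3 r l = 0.
Proof. by rewrite /ind3 => /negbTE ->. Qed.

Ltac ind3_eval := repeat match goal with
  |- context [ind3 ?r ?l] =>
    first [ rewrite (@ind3T r l); [|lia] | rewrite (@ind3F r l); [|lia] ]
  end.

(* 2 (N(a, b) - 1) for a = 2 m + n + 1 and b = m + 2 n + 1: these are all the
   (a, b) with a + b = 2 mod 3. *)
Definition eisE (x : int * int) : int :=
  6 * (x.1 ^+ 2 + x.1 * x.2 + x.2 ^+ 2 + x.1 + x.2).

Lemma admissible_eisE : admissible eisE.
Proof.
(* Completing the square in n leaves a quadratic in m alone, so the exponent bounds |m| and, by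
   symmetry, |n|. *)
have le1 (m n : int) : `|m| - 1 <= 4 * (m ^+ 2 + m * n + n ^+ 2 + m + n).
  have -> : 4 * (m ^+ 2 + m * n + n ^+ 2 + m + n) =
    (2 * n + m + 1) ^+ 2 + (3 * m ^+ 2 + 2 * m - 1) by ring.
  have := sqr_ge0 (2 * n + m + 1).
  have : `|m| - 1 <= 3 * m ^+ 2 + 2 * m - 1 by rewrite expr2; nia.
  lia.
have eC (m n : int) : m ^+ 2 + m * n + n ^+ 2 + m + n = n ^+ 2 + n * m + m ^+ 2 + n + m.
  by ring.
split=> [[m n]|k]; first by rewrite /eisE /=; have := le1 m n; lia.
apply: sub_finite_set (finite_setX (finite_int_itv (- k%:Z - 1) (k%:Z + 1))
  (finite_int_itv (- k%:Z - 1) (k%:Z + 1))).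
move=> [m n]; rewrite /eisE /= => H.
by have := le1 m n; have := le1 n m; rewrite -eC => H1 H2; split; lia.
Qed.

Lemma zsign2D k t : zsign (k + 2 * t) = zsign k.
Proof. by rewrite /zsign; case: ifP; case: ifP; lia. Qed.

Lemma zsign2D1 k t : zsign (k + (2 * t + 1)) = - zsign k.
Proof. by rewrite /zsign; case: ifP; case: ifP; lia. Qed.

Section Eighth.

Let I3 := ((int * int) * int)%type.
Let E3 (x : I3) : int :=
  3 * (x.1.1 ^+ 2 - x.1.1) + 3 * (x.1.2 ^+ 2 - x.1.2) + 3 * (x.2 ^+ 2 - x.2).
Let sg (x : I3) := zsign (x.1.1 + x.1.2 + x.2).
Let tot (x : I3) := x.1.1 + x.1.2 + x.2.
(** Unlike i j k, this weight is invariant under translation along (1, 1, 1). *)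
Let cub (x : I3) := (x.1.1 - x.2) ^+ 2 * (x.1.2 - x.2).

Let aE3 : admissible E3.
Proof.
have aE : admissible (fun k : int => 3 * (k ^+ 2 - k)).
  have := @admissible_quadr 3 0; rewrite add0r.
  by under eq_fun => x do rewrite mul1r; apply.
exact: admissibleD (admissibleD aE aE) aE.
Qed.

(* i -> 1 - i preserves the exponent and changes the sign, so a weight that misses
   one of the three indices contributes nothing. *)
Let ser_miss (f : int -> int -> int) n :
  [/\ ser E3 (fun x => sg x * f x.1.2 x.2) n = 0,
      ser E3 (fun x => sg x * f x.1.1 x.2) n = 0 &
      ser E3 (fun x => sg x * f x.1.1 x.1.2) n = 0].
Proof.
split.
- apply: (@ser_anti _ (fun x => ((1 - x.1.1, x.1.2), x.2))) => // -[[i j] k] /=.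
  + by congr (_, _, _); ring.
  + by rewrite /E3 /=; ring.
  + rewrite /sg /= -mulNr; congr (_ * _).
    by rewrite -(zsign2D1 _ (- i)); congr zsign; ring.
- apply: (@ser_anti _ (fun x => ((x.1.1, 1 - x.1.2), x.2))) => // -[[i j] k] /=.
  + by congr (_, _, _); ring.
  + by rewrite /E3 /=; ring.
  + rewrite /sg /= -mulNr; congr (_ * _).
    by rewrite -(zsign2D1 _ (- j)); congr zsign; ring.
- apply: (@ser_anti _ (fun x => ((x.1.1, x.1.2), 1 - x.2))) => // -[[i j] k] /=.
  + by congr (_, _, _); ring.
  + by rewrite /E3 /=; ring.
  + rewrite /sg /= -mulNr; congr (_ * _).
    by rewrite -(zsign2D1 _ (- k)); congr zsign; ring.
Qed.

(** In the expansion of [cub], every monomial other than - 2 i j k misses an index. *)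
Let ser_cub n : ser E3 (fun x => sg x * cub x) n =
  -2 * ser E3 (fun x => sg x * (x.1.1 * x.1.2 * x.2)) n.
Proof.
rewrite -serZ // -[RHS]addr0.
have [Z1 _ _] := ser_miss (fun j k => k ^+ 2 * j) n.
have [_ Z2 _] := ser_miss (fun i k => - (i ^+ 2 * k) + 2 * i * k ^+ 2 - k ^+ 3) n.
have [_ _ Z3] := ser_miss (fun i j => i ^+ 2 * j) n.
rewrite -Z3 -[X in _ = _ + X]addr0 -Z2 -[X in _ = _ + (_ + X)]addr0 -Z1 -!serD //.
by apply: eq_ser => -[[i j] k]; rewrite /cub /=; ring.
Qed.

(* For i + j + k = 0 mod 3, the sum along (1, 1, 1) has an antisymmetry. *)
Let ser_cub0 n : ser E3 (fun x => ind3 0 (tot x) * (sg x * cub x)) n = 0.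
Proof.
(* The translation by u along (1, 1, 1) takes the mean s of the three indices to 1 - s. It preserves
   the exponent, and u = 1 - 2 s is odd, so the sign changes. *)
pose h (x : I3) : I3 := let u := 1 - 2 * x.2 - 2 * ((x.1.1 + x.1.2 - 2 * x.2) %/ 3)%Z in
  ((x.1.1 + u, x.1.2 + u), x.2 + u).
apply: (@ser_anti_on _ (fun x => (tot x %% 3)%Z == 0) h) => //.
- by move=> [[i j] k]; rewrite /tot /h /=; lia.
- by move=> [[i j] k]; rewrite /tot /h /= => D; congr (_, _, _); lia.
- move=> [[i j] k]; rewrite /tot /h /E3 /= => D; set c := (_ %/ 3)%Z.
  have -> : i = 3 * c - j + 2 * k by rewrite /c; lia.
  by ring.
- move=> [[i j] k] D; rewrite ind3T; last by move: D; rewrite /tot /h /=; lia.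
  rewrite ind3T ?(eqP D) // !mul1r /sg /cub /h /= -[RHS]mulNr; congr (_ * _); last by ring.
  set c := (_ %/ 3)%Z.
  by rewrite -(zsign2D1 _ (1 - 3 * k - 3 * c)); congr zsign; ring.
- by move=> x D; rewrite ind3F ?mul0r.
Qed.

(** Replacing every index by 1 minus itself exchanges the classes 1 and 2; the sign and the cubic
    weight both change sign. *)
Let ser_cub12 n : ser E3 (fun x => ind3 1 (tot x) * (sg x * cub x)) n =
  ser E3 (fun x => ind3 2 (tot x) * (sg x * cub x)) n.
Proof.
apply: (@ser_bij _ (fun x => ((1 - x.1.1, 1 - x.1.2), 1 - x.2))
                   (fun x => ((1 - x.1.1, 1 - x.1.2), 1 - x.2))) => //.
- by move=> [[i j] k] /=; congr (_, _, _); ring.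
- by move=> [[i j] k] /=; congr (_, _, _); ring.
- by move=> [[i j] k]; rewrite /E3 /=; ring.
move=> [[i j] k]; rewrite /tot /sg /cub /=; congr (_ * _).
  by rewrite /ind3; congr (if _ then _ else _); lia.
have -> : zsign (1 - i + (1 - j) + (1 - k)) = - zsign (i + j + k).
  by rewrite -(zsign2D1 _ (1 - (i + j + k))); congr zsign; ring.
by ring.
Qed.

(** The coordinate t along (1, 1, 1) separates from the transverse coordinates: the exponent splits
    into a pentagonal one and the norm form, and [cub] becomes a^2 b. *)
Let ser_cub2 n : ser E3 (fun x => ind3 2 (tot x) * (sg x * cub x)) n =
  ser (fun x : int * (int * int) => 3 * (3 * x.1 ^+ 2 - x.1) + eisE x.2)
    (fun x => zsign x.1 * ((2 * x.2.1 + x.2.2 + 1) ^+ 2 * (x.2.1 + 2 * x.2.2 + 1))) n.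
Proof.
apply: (@ser_reindex _ _ (fun x => ((x.2.1 - x.1 + 1, x.2.2 - x.1 + 1),
   - x.1 - x.2.1 - x.2.2))) => //.
- by move=> [t [m n']] [t' [m' n'']] /= [] *; congr (_, (_, _)); lia.
- by move=> [t [m n']]; rewrite /E3 /eisE /=; ring.
- move=> [t [m n']]; rewrite ind3T ?mul1r; last by rewrite /tot /=; lia.
  rewrite /sg /cub /=; congr (_ * _); last by ring.
  by rewrite -[RHS](zsign2D _ (1 - 2 * t)); congr zsign; ring.
- move=> [[i j] k] H; have D : (tot ((i, j), k) %% 3)%Z = 2.
    by move: H; rewrite /ind3; case: ifP => [/eqP|_] //; rewrite mul0r eqxx.
  move: D; rewrite /tot /= => D.
  exists (- k - ((i + j - 2 * k - 2) %/ 3)%Z,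
    (((2 * i - j - k - 1) %/ 3)%Z, ((2 * j - i - k - 1) %/ 3)%Z)) => /=.
  by congr (_, _, _); lia.
Qed.

Lemma ser_jacobi3 n :
  ser E3 (fun x => zsign x.1.1 * x.1.1 * (zsign x.1.2 * x.1.2) * (zsign x.2 * x.2)) n =
  - ser (fun x : int * (int * int) => 3 * (3 * x.1 ^+ 2 - x.1) + eisE x.2)
    (fun x => zsign x.1 * ((2 * x.2.1 + x.2.2 + 1) ^+ 2 * (x.2.1 + 2 * x.2.2 + 1))) n.
Proof.
rewrite -ser_cub2; have C := ser_cub n.
have : ser E3 (fun x => sg x * cub x) n =
    ser E3 (fun x => ind3 0 (tot x) * (sg x * cub x)) n +
    (ser E3 (fun x => ind3 1 (tot x) * (sg x * cub x)) n +
    ser E3 (fun x => ind3 2 (tot x) * (sg x * cub x)) n).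
  rewrite -!serD //; apply: eq_ser => x; rewrite -!mulrDl -[LHS]mul1r; congr (_ * _).
  by rewrite /ind3; do 3!case: eqP; lia.
rewrite ser_cub0 ser_cub12 add0r C.
set A := ser _ _ _; set B := ser _ _ _ => AB.
rewrite (_ : ser _ _ _ = A); first by lia.
by apply: eq_ser => x; rewrite /sg !zsignD; ring.
Qed.

End Eighth.

(** After multiplication by (q), the claim concerns (q)^9, the cube of (q)^3. *)
Lemma qfac8 N M : (N <= M)%N -> gf N (qfac 'X^6 M ^+ 8) eisE
  (fun x => (2 * x.1 + x.2 + 1) ^+ 2 * (x.1 + 2 * x.2 + 1)).
Proof.
move=> NM; set w := fun x => _.
have J := @jacobi N M 3 isT NM; have Q := @euler N M 3 isT NM.
rewrite [(2 * 3)%N]/= in J Q.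
have A := gf_ser N w admissible_eisE.
apply: (gf_eqm _ A); apply: (@eqmI _ (qfac 'X^6 M)); first exact: coef0_qfac.
set P := qfac _ _ in J Q *.
have -> : P * P ^+ 8 = - (- P ^+ 3 * - P ^+ 3 * - P ^+ 3) by ring.
apply: (eqm_gf (gfM Q A) (gfN (gfM (gfM J J) J))) => n.
by rewrite serN ?ser_jacobi3 ?opprK //; case: (gfM (gfM J J) J).
Qed.

(** * The product of two squares *)

Section Second.

Let I3 := (int * (int * int))%type.
Let E (x : I3) : int := 3 * (x.1 ^+ 2 - x.1) + eisE x.2.
Let d (x : I3) := x.2.1 - x.2.2.
Let l (x : I3) := x.1 + d x.
(** The nontrivial character mod 3. *)
Let eps k := ind3 1 k - ind3 2 k.

Let aE : admissible E.
Proof.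
have aE : admissible (fun k : int => 3 * (k ^+ 2 - k)).
  have := @admissible_quadr 3 0; rewrite add0r.
  by under eq_fun => x do rewrite mul1r; apply.
exact: admissibleD aE admissible_eisE.
Qed.

Let flip (x : I3) : I3 := (1 - x.1, x.2).
Let swap (x : I3) : I3 := (x.1, (x.2.2, x.2.1)).
(** Multiplication of a + b w by the cube root of unity w; it lowers [d] by 1 mod 3. *)
Let rot (x : I3) : I3 := (x.1, (- x.2.1 - x.2.2 - 1, x.2.1)).
Let W1 (x : I3) := ind3 0 x.1 * ind3 1 (d x) * (zsign x.1 * d x).
Let Wd (x : I3) := eps (l x) * (zsign x.1 * d x).
Let Wk (x : I3) := eps (l x) * (zsign x.1 * x.1).

Let flip_ser w n : ser E (fun x => w (flip x)) n = ser E w n.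
Proof.
symmetry; apply: (@ser_bij _ flip flip) => //.
- by move=> [k x]; rewrite /flip /=; congr (_, _); ring.
- by move=> [k x]; rewrite /flip /=; congr (_, _); ring.
- by move=> [k x]; rewrite /flip /E /=; ring.
Qed.

Let swap_ser w n : ser E (fun x => w (swap x)) n = ser E w n.
Proof.
symmetry; apply: (@ser_bij _ swap swap) => //.
- by move=> [k [i j]].
- by move=> [k [i j]].
- by move=> [k [i j]]; rewrite /swap /E /eisE /=; ring.
Qed.

Let rot_ser w n : ser E (fun x => w (rot x)) n = ser E w n.
Proof.
symmetry; apply: (@ser_bij _ rot (fun x => (x.1, (x.2.2, - x.2.1 - x.2.2 - 1)))) => //.
- by move=> [k [i j]]; rewrite /rot /=; congr (_, (_, _)); ring.
- by move=> [k [i j]]; rewrite /rot /=; congr (_, (_, _)); ring.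
- by move=> [k [i j]]; rewrite /rot /E /eisE /=; ring.
Qed.

(** [flip] and [swap] generate a group of order 4 preserving the exponent. Summed over this group,
    [Wd] and 3 [W1] agree pointwise, as the residues of k and d mod 3 show. *)
Let ser_W1 n : ser E Wd n = 3 * ser E W1 n.
Proof.
rewrite -serZ //; set W := fun x => 3 * _.
suff : 4 * ser E Wd n = 4 * ser E W n by lia.
have sym4 w : 4 * ser E w n = ser E
    (fun x => (w x + w (flip x)) + (w (swap x) + w (flip (swap x)))) n.
  rewrite !serD // (flip_ser w) (swap_ser (fun x => w (flip x))) (flip_ser w) (swap_ser w); ring.
rewrite !sym4; apply: eq_ser => -[k [i j]].
rewrite /W /Wd /W1 /eps /l /d /flip /swap /=.
have -> : zsign (1 - k) = - zsign k.
  by rewrite -(zsign2D1 _ (- k)); congr zsign; ring.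
have [k0|[k0|k0]] : (k %% 3)%Z = 0 \/ (k %% 3)%Z = 1 \/ (k %% 3)%Z = 2 by lia.
- have [d0|[d0|d0]] : ((i - j) %% 3)%Z = 0 \/ ((i - j) %% 3)%Z = 1 \/ ((i - j) %% 3)%Z = 2 by lia.
  + by ind3_eval; ring.
  + by ind3_eval; ring.
  + by ind3_eval; ring.
- have [d0|[d0|d0]] : ((i - j) %% 3)%Z = 0 \/ ((i - j) %% 3)%Z = 1 \/ ((i - j) %% 3)%Z = 2 by lia.
  + by ind3_eval; ring.
  + by ind3_eval; ring.
  + by ind3_eval; ring.
- have [d0|[d0|d0]] : ((i - j) %% 3)%Z = 0 \/ ((i - j) %% 3)%Z = 1 \/ ((i - j) %% 3)%Z = 2 by lia.
  + by ind3_eval; ring.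
  + by ind3_eval; ring.
  + by ind3_eval; ring.
Qed.

(** [rot] fixes k and cycles l through the residues mod 3, over which [eps] sums to 0. *)
Let ser_Wk n : ser E Wk n = 0.
Proof.
suff : 3 * ser E Wk n = 0 by lia.
have -> : 3 * ser E Wk n = ser E (fun x => Wk x + (Wk (rot x) + Wk (rot (rot x)))) n.
  rewrite !serD // (rot_ser (fun x => Wk (rot x))) rot_ser; ring.
rewrite (@eq_ser _ _ _ (fun x => 0 * Wk x)) ?serZ ?mul0r // => -[k [i j]].
rewrite /Wk /eps /l /d /rot /=.
have [k0|[k0|k0]] : ((k + (i - j)) %% 3)%Z = 0 \/ ((k + (i - j)) %% 3)%Z = 1 \/
   ((k + (i - j)) %% 3)%Z = 2 by lia.
- by ind3_eval; ring.
- by ind3_eval; ring.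
- by ind3_eval; ring.
Qed.

(** For fixed l and m the exponent is 9 n^2 + (6 l + 3) n up to a constant. With l = 3 c + 1, the
    map n -> - 2 c - 1 - n preserves it and changes k by an odd amount. *)
Let ser_l1 n : ser E (fun x => ind3 1 (l x) * (zsign x.1 * l x)) n = 0.
Proof.
pose h (x : I3) : I3 := let u := 2 * ((l x - 1) %/ 3)%Z + 1 + 2 * x.2.2 in
  (x.1 - u, (x.2.1, x.2.2 - u)).
have lh x : l (h x) = l x by rewrite /l /d /h /=; ring.
apply: (@ser_anti_on _ (fun x => (l x %% 3)%Z == 1) h) => //.
- by move=> x; rewrite lh.
- move=> [k [i j]] _; rewrite {1}/h lh /h /=; congr (_, (_, _)); ring.
- move=> [k [i j]]; rewrite /h /E /eisE /l /d /= => D; set c := (_ %/ 3)%Z.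
  have -> : k = 3 * c + 1 - i + j by rewrite /c; lia.
  by ring.
- move=> x D; rewrite lh -mulrN -mulNr; congr (_ * (_ * _)).
  rewrite /h /= -(zsign2D1 _ (- (((l x - 1) %/ 3)%Z + 1 + x.2.2))).
  by congr zsign; ring.
- by move=> x D; rewrite ind3F ?mul0r.
Qed.

(** With l = 3 h - 1, the map h -> 1 - h fixing m - h and n + h preserves the exponent and changes k
    by an odd amount. *)
Let ser_l2 n : ser E (fun x => ind3 2 (l x) * zsign x.1) n = 0.
Proof.
pose h (x : I3) : I3 := let u := 1 - 2 * ((l x + 1) %/ 3)%Z in
  (x.1 + u, (x.2.1 + u, x.2.2 - u)).
have lh x : l (h x) = l x + 3 * (1 - 2 * ((l x + 1) %/ 3)%Z).
  by rewrite /l /d /h /=; ring.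
apply: (@ser_anti_on _ (fun x => (l x %% 3)%Z == 2) h) => //.
- by move=> x; rewrite lh; lia.
- move=> [k [i j]] D; rewrite {1}/h lh; set c := l _ in D *.
  by rewrite /h /= -/c; congr (_, (_, _)); lia.
- move=> [k [i j]]; rewrite /h /E /eisE /l /d /= => D; set c := (_ %/ 3)%Z.
  have -> : k = 3 * c - 1 - i + j by rewrite /c; lia.
  by ring.
- move=> x D; rewrite ind3T; last by rewrite lh; lia.
  rewrite ind3T ?(eqP D) // !mul1r /h /=.
  rewrite -(zsign2D1 _ (- ((l x + 1) %/ 3)%Z)).
  by congr zsign; ring.
- by move=> x D; rewrite ind3F ?mul0r.
Qed.

Let W2 (x : I3) := ind3 2 (l x) * (zsign x.1 * ((l x + 1) %/ 3)%Z).

(** Adding [Wk], which sums to 0, turns the weight d of [Wd] into l = k + d. The class l = 1 mod 3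
    drops out; on l = 3 h - 1 the constant drops out too, leaving - 3 h. *)
Let ser_W12 n : ser E W1 n = - ser E W2 n.
Proof.
suff : 3 * ser E W1 n = - (3 * ser E W2 n) by lia.
rewrite -ser_W1 -[LHS]addr0 -(ser_Wk n) -serD // -serZ // -serN //.
rewrite -[RHS]addr0 -(ser_l1 n) -[RHS]addr0 -(ser_l2 n) -!serD //.
apply: eq_ser => x; rewrite /Wd /Wk /W2.
rewrite -mulrDr -mulrDr [d x + _]addrC -/(l x) /eps.
have [/eqP l2|nl2] := boolP ((l x %% 3)%Z == 2); last by rewrite (ind3F nl2); ring.
have : l x = 3 * ((l x + 1) %/ 3)%Z - 1 by lia.
have aux (a b z q L : int) : L = 3 * q - 1 ->
  (a - b) * (z * L) = - (3 * (b * (z * q))) + a * (z * L) + b * z by move=> ->; ring.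
exact: aux.
Qed.

(* W1 lives on k = 0 mod 3, where the signed sum over k is Euler's series in q^3,
   and W2 on l = 2 mod 3, written l = 3 h - 1, where m and n are shifted to
   pentagonal position. *)
Lemma ser_euler_jacobi n :
  ser (fun x : int * (int * int) => 9 * (3 * x.1 ^+ 2 - x.1) + eisE x.2)
    (fun x => zsign x.1 * (ind3 1 (x.2.1 - x.2.2) * (x.2.1 - x.2.2))) n =
  - ser (fun x : (int * int) * int => 3 * (3 * x.1.1 ^+ 2 - x.1.1) +
       3 * (3 * x.1.2 ^+ 2 - x.1.2) + 9 * (x.2 ^+ 2 - x.2))
    (fun x => zsign x.1.1 * zsign x.1.2 * (zsign x.2 * x.2)) n.
Proof.
have <- : ser E W1 n = ser (fun x : int * (int * int) => 9 * (3 * x.1 ^+ 2 - x.1) + eisE x.2)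
    (fun x => zsign x.1 * (ind3 1 (x.2.1 - x.2.2) * (x.2.1 - x.2.2))) n.
  apply: (@ser_reindex _ _ (fun x => (3 * x.1, x.2))) => //.
  - by move=> [k x] [k' x'] [] kk ->; congr (_, _); lia.
  - by move=> [k x]; rewrite /E /=; ring.
  - move=> [k x]; rewrite /W1 /d /= ind3T; last by lia.
    have -> : zsign (3 * k) = zsign k by rewrite -[RHS](zsign2D _ k); congr zsign; ring.
    by ring.
  - move=> [k x]; have [/eqP k0|k0] := boolP ((k %% 3)%Z == 0); last first.
      by rewrite /W1 /= (ind3F k0) !mul0r eqxx.
    by move=> _; exists ((k %/ 3)%Z, x); congr (_, _) => /=; lia.
rewrite ser_W12; congr (- _).
apply: (@ser_reindex _ _ (fun x : (int * int) * int =>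
   (x.2 - x.1.1 + x.1.2, (x.1.1 + x.2 - 1, x.1.2 - x.2)))) => //.
- by move=> [[i j] k] [[i' j'] k'] /= [] *; congr (_, _, _); lia.
- by move=> [[i j] k]; rewrite /E /eisE /=; ring.
- move=> [[i j] k]; rewrite /W2 ind3T; last by rewrite /l /d /=; lia.
  rewrite mul1r /= (_ : (_ %/ 3)%Z = k); last by rewrite /l /d /=; lia.
  rewrite mulrA -!zsignD; congr (_ * _).
  by rewrite -[RHS](zsign2D _ (- i)); congr zsign; ring.
- move=> x H; have D : (l x %% 3)%Z = 2.
    by move: H; rewrite /W2 /ind3; case: ifP => [/eqP|_] //; rewrite mul0r eqxx.
  move: x D {H} => [k [i j]]; rewrite /l /d /= => D.
  exists ((i + 1 - ((k + (i - j) + 1) %/ 3)%Z, j + ((k + (i - j) + 1) %/ 3)%Z),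
    ((k + (i - j) + 1) %/ 3)%Z) => /=.
  by congr (_, (_, _)); lia.
Qed.

End Second.

(** After multiplication by (q^3), the claim concerns (q)^2 (q^3)^3, two Euler series and one Jacobi
    series. *)
Lemma qfac2_qfac2 N M : (N <= M)%N ->
  gf N (qfac 'X^6 M ^+ 2 * qfac 'X^18 M ^+ 2) eisE
  (fun x => ind3 1 (x.1 - x.2) * (x.1 - x.2)).
Proof.
move=> NM; set w := fun x => _.
have J := @jacobi N M 9 isT NM; have Q := @euler N M 3 isT NM.
have Q' := @euler N M 9 isT NM; rewrite [(2 * 3)%N]/= [(2 * 9)%N]/= in J Q Q'.
have A := gf_ser N w admissible_eisE.
apply: (gf_eqm _ A); apply: (@eqmI _ (qfac 'X^18 M)); first exact: coef0_qfac.
set P := qfac _ M in J Q' *; set P' := qfac _ M in Q *.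
have -> : P * (P' ^+ 2 * P ^+ 2) = - (P' * P' * - P ^+ 3) by ring.
apply: (eqm_gf (gfM Q' A) (gfN (gfM (gfM Q Q) J))) => n.
by rewrite serN ?ser_euler_jacobi //; case: (gfM (gfM Q Q) J).
Qed.

(** * Representations of a prime by the norm form *)

Definition eisN (a b : int) : int := a ^+ 2 - a * b + b ^+ 2.

Lemma prime_dvdzM (p : nat) (a b : int) :
  prime p -> (p %| a * b)%Z -> (p %| a)%Z \/ (p %| b)%Z.
Proof. by move=> pp; rewrite !dvdzE abszM Euclid_dvdM // => /orP. Qed.

Lemma modz3P (x r : int) : (x %% 3)%Z = r -> exists y, x = 3 * y + r.
Proof. by move=> <-; exists (x %/ 3)%Z; rewrite {1}(divz_eq x 3) [_ * 3]mulrC. Qed.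

Lemma modz3E (x y r : int) : 0 <= r < 3 -> x = 3 * y + r -> (x %% 3)%Z = r.
Proof. by lia. Qed.

Lemma modz3_small (x : int) : (x %% 3)%Z = 0 -> 3 * x ^+ 2 <= 4 -> x = 0.
Proof.
move=> x3 x4; apply/eqP; apply: contraT => x0.
have : 3 ^+ 2 <= x ^+ 2 by rewrite -(real_normK (num_real x)) lerXn2r // ?nnegrE; lia.
by lia.
Qed.

(* With w a primitive cube root of unity, p divides the product u - v w of a + b w
   and the conjugate of c + d w; the quotient is a unit, and it is 1 because of the
   residues mod 3. *)
Lemma eisN_associated (p : nat) (a b c d : int) : prime p ->
  (a %% 3)%Z = 0 -> (b %% 3)%Z = 2 -> (c %% 3)%Z = 0 -> (d %% 3)%Z = 2 ->
  eisN a b = p -> eisN c d = p -> (p %| a * d - b * c)%Z -> c = a /\ d = b.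
Proof.
move=> pp a3 b3 c3 d3 abp cdp pv.
pose u := a * c - a * d + b * d; pose v := a * d - b * c.
have uv : u ^+ 2 + u * v + v ^+ 2 = p%:Z ^+ 2.
  by rewrite [RHS]expr2 -{1}abp -cdp /u /v /eisN; ring.
have pu : (p %| u)%Z.
  have : (p %| u * u)%Z.
    have -> : u * u = p%:Z * p%:Z + (- u - v) * v by rewrite -(expr2 p%:Z) -uv; ring.
    by apply: rpredD; [apply: dvdz_mulr | apply: dvdz_mull].
  by move=> /(prime_dvdzM pp) [].
have p0 : p%:Z != 0 by case: (p) pp.
have [u' uE] := dvdzP pu; have [v' vE] := dvdzP pv.
have uv1 : u' ^+ 2 + u' * v' + v' ^+ 2 = 1.
  by apply: (mulIf (expf_neq0 2 p0)); rewrite mul1r -[RHS]uv uE /v vE; ring.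
have [[a1 aE] [b1 bE]] := (modz3P a3, modz3P b3).
have [[c1 cE] [d1 dE]] := (modz3P c3, modz3P d3).
have [q pE] : exists q, p%:Z = 3 * q + 1.
  exists (3 * a1 ^+ 2 - 3 * a1 * b1 - 2 * a1 + 3 * b1 ^+ 2 + 4 * b1 + 1).
  by rewrite -abp /eisN aE bE; ring.
have u1 : (u' %% 3)%Z = 1.
  apply: (@modz3E _ (3 * a1 * c1 - 3 * a1 * d1 - 2 * a1 + 3 * b1 * d1 + 2 * b1
     + 2 * d1 - u' * q + 1)) => //.
  transitivity (u - 3 * (u' * q)); first by rewrite uE pE; ring.
  by rewrite /u aE bE cE dE; ring.
have v0 : (v' %% 3)%Z = 0.
  apply: (@modz3E _ (3 * a1 * d1 + 2 * a1 - 3 * b1 * c1 - 2 * c1 - v' * q)) => //.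
  transitivity (a * d - b * c - 3 * (v' * q)); first by rewrite vE pE; ring.
  by rewrite aE bE cE dE; ring.
(* The norm equation gives 3 v'^2 <= 4, and 3 divides v'. *)
have v'0 : v' = 0.
  apply: (modz3_small v0); rewrite -subr_ge0.
  suff -> : 4 - 3 * v' ^+ 2 = (2 * u' + v') ^+ 2 by apply: sqr_ge0.
  transitivity (4 * (u' ^+ 2 + u' * v' + v' ^+ 2) - 3 * v' ^+ 2); last by ring.
  by rewrite uv1 mulr1.
have u'1 : u' = 1.
  move/eqP: uv1; rewrite v'0 mulr0 expr0n !addr0 sqrf_eq1.
  by case/orP => /eqP u'E //; move: u1; rewrite u'E.
move: uE vE; rewrite u'1 v'0 mul1r mul0r /u => uE vE.
split; apply: (mulfI p0).
  transitivity (a * (a * c - a * d + b * d) + (b - a) * - (a * d - b * c)).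
    by rewrite -abp /eisN; ring.
  by rewrite uE vE; ring.
transitivity (b * (a * c - a * d + b * d) + a * (a * d - b * c)).
  by rewrite -abp /eisN; ring.
by rewrite uE vE; ring.
Qed.

(** The pair (- c, d - c) is the conjugate of (c, d) up to a unit, with the same residues. The
    product of the two determinants is p (a^2 - c^2), so p divides one of them. *)
Lemma eisN_unique (p : nat) (a b c d : int) : prime p ->
  (a %% 3)%Z = 0 -> (b %% 3)%Z = 2 -> (c %% 3)%Z = 0 -> (d %% 3)%Z = 2 ->
  eisN a b = p -> eisN c d = p ->
  (c = a /\ d = b) \/ (c = - a /\ d = b - a).
Proof.
move=> pp a3 b3 c3 d3 abp cdp.
have : (p %| (a * d - b * c) * (a * (d - c) - b * - c))%Z.
  apply/dvdzP; exists (a ^+ 2 - c ^+ 2).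
  transitivity (a ^+ 2 * (eisN c d - c ^+ 2) - c ^+ 2 * (eisN a b - a ^+ 2)).
    by rewrite /eisN; ring.
  by rewrite abp cdp; ring.
case/(prime_dvdzM pp) => [/(eisN_associated pp a3 b3 c3 d3 abp cdp)|D]; first by left.
right; suff [] : - c = a /\ d - c = b by lia.
apply: (eisN_associated pp a3 b3 _ _ abp _ D); first by lia.
  by lia.
by rewrite -cdp /eisN; ring.
Qed.

(** Multiplication by cube roots of unity preserves the norm and permutes the classes of m - n mod
    3, so the sum folds onto the class 1, where a = 0 and b = 2 mod 3. *)
Lemma ser_eis_rotate (w : int * int -> int) n :
  ser eisE w n = ser eisE (fun x => ind3 1 (x.1 - x.2) *
    (w x + w (- x.1 - x.2 - 1, x.1) + w (x.2, - x.1 - x.2 - 1))) n.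
Proof.
pose r (x : int * int) := (- x.1 - x.2 - 1, x.1).
pose r' (x : int * int) := (x.2, - x.1 - x.2 - 1).
have rK : cancel r r' by move=> [i j]; rewrite /r /r' /=; congr (_, _); ring.
have r'K : cancel r' r by move=> [i j]; rewrite /r /r' /=; congr (_, _); ring.
have aE := admissible_eisE.
have -> : ser eisE w n = ser eisE (fun x => ind3 1 (x.1 - x.2) * w x) n +
   (ser eisE (fun x => ind3 0 (x.1 - x.2) * w x) n +
    ser eisE (fun x => ind3 2 (x.1 - x.2) * w x) n).
  rewrite -!serD //; apply: eq_ser => x; rewrite -!mulrDl -[LHS]mul1r; congr (_ * _).
  by rewrite /ind3; do 3!case: eqP; lia.
rewrite (@ser_bij _ r r' _ (fun x => ind3 0 (x.1 - x.2) * w x)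
   (fun x => ind3 1 (x.1 - x.2) * w (r x)) _ aE rK r'K); last 2 first.
- by move=> [i j]; rewrite /eisE /r /=; ring.
- move=> [i j]; congr (_ * _); rewrite /ind3 /r /=; congr (if _ then _ else _); lia.
rewrite (@ser_bij _ r' r _ (fun x => ind3 2 (x.1 - x.2) * w x)
   (fun x => ind3 1 (x.1 - x.2) * w (r' x)) _ aE r'K rK); last 2 first.
- by move=> [i j]; rewrite /eisE /r' /=; ring.
- move=> [i j]; congr (_ * _); rewrite /ind3 /r' /=; congr (if _ then _ else _); lia.
by rewrite -!serD //; apply: eq_ser => x; rewrite -!mulrDr addrA.
Qed.

(** The exponent 2 (p - 1) means N(a, b) = p. The second index stands for (- a, b - a), and
    [eisN_unique] excludes any other. *)
Lemma ser_eis_prime (p : nat) : prime p ->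
  (forall w, ser eisE (fun x => ind3 1 (x.1 - x.2) * w x) (2 * p.-1) = 0) \/
  exists x : int * int, forall w,
    ser eisE (fun x => ind3 1 (x.1 - x.2) * w x) (2 * p.-1) =
    w x + w (- x.1 - x.2 - 1, x.2).
Proof.
move=> pp; have p0 := prime_gt0 pp.
pose K (x : int * int) := eisE x = (2 * p.-1)%N%:Z /\ ((x.1 - x.2) %% 3)%Z = 1.
pose a (x : int * int) := 2 * x.1 + x.2 + 1.
pose b (x : int * int) := x.1 + 2 * x.2 + 1.
have KP x : K x -> [/\ (a x %% 3)%Z = 0, (b x %% 3)%Z = 2 & eisN (a x) (b x) = p].
  case: x => m n [/= Kx d1]; split; [by rewrite /a /=; lia | by rewrite /b /=; lia |].
  have : 2 * eisN (a (m, n)) (b (m, n)) = eisE (m, n) + 2.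
    by rewrite /eisN /eisE /a /b /=; ring.
  by rewrite Kx; lia.
case: (pselect (exists x, K x)) => [[x Kx]|nK]; [right|left]; last first.
  move=> w; apply: fsbig1 => x /= Ex; rewrite ind3F ?mul0r //.
  by apply: contra_notN nK => /eqP d1; exists x.
have [a0 b2 ab] := KP x Kx.
exists x => w; pose y := (- x.1 - x.2 - 1, x.2).
have Ky : K y.
  rewrite /y; case: (x) Kx => m n [/= Ex d1]; split; last by rewrite /=; lia.
  by rewrite -Ex /eisE /=; ring.
(* Equality would force a = 0, making p the square of b. *)
have xy : x != y.
  apply/eqP => xy; have a00 : a x = 0.
    by have := congr1 fst xy; rewrite /y /a /=; lia.
  move: ab; rewrite a00 /eisN expr0n /= mul0r subr0 add0r => bp.
  have {}bp : (p = `|b x| * `|b x|)%N by rewrite -abszM -expr2 bp.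
  have /primeP [p1 /(_ `|b x|%N)] := pp.
  by rewrite {1}bp dvdn_mulr // => /(_ isT) /orP[] /eqP bE; move: bp p1; rewrite bE; nia.
rewrite /ser (fsbigE [:: x; y]); last 3 first.
- by rewrite /= inE xy.
- by move=> z /=; rewrite !inE => /orP[] /eqP ->; [case: Kx | case: Ky].
- move=> z /= Ez; rewrite !inE => zxy; rewrite ind3F ?mul0r //.
  apply: contra zxy => /eqP d1; have [//|za zb zp] := KP z.
  have := eisN_unique pp a0 b2 za zb ab zp.
  rewrite /y /a /b; case: x z {Kx a0 b2 ab y Ky xy Ez d1 za zb zp} => m n [m' n'] /= H.
  suff [[-> ->]|[-> ->]] : (m' = m /\ n' = n) \/ (m' = - m - n - 1 /\ n' = n).
  - by rewrite eqxx.
  - by rewrite eqxx orbT.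
  by lia.
rewrite !big_cons big_nil !ifT ?inE /=; first last.
- by case: Kx.
- by case: Ky.
by case: Kx Ky => _ dx [_ dy]; rewrite !ind3T // !mul1r addr0.
Qed.

(** * The divisibility of the coefficients *)

Lemma comp_qfac (k d M : nat) : (qfac 'X^d M : {poly int}) \Po 'X^k = qfac 'X^(k * d) M.
Proof.
rewrite /qfac rmorph_prod /=; apply: eq_bigr => i _.
by rewrite rmorphB rmorph1 /= !rmorphXn /= comp_polyX exprM.
Qed.

Lemma prod_qfac d M k :
  \prod_(1 <= n < M.+1) (1 - 'X^(d * n)) ^+ k = qfac ('X^d : {poly int}) M ^+ k.
Proof.
rewrite big_add1 /= big_mkord prodrXl /qfac; congr (_ ^+ _).
by apply: eq_bigr => i _; rewrite exprM.
Qed.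

Theorem mainTheorem2 (a c : nat -> int) (p : nat) :
  is_astar a -> is_cstar c -> prime p -> p = 1 %[mod 3] -> (c p %| a p)%Z.
Proof.
move=> /(_ p) [Na aP] /(_ p) [Nc cP] pp _.
pose M := maxn (maxn Na Nc) (2 * p).
have p0 := prime_gt0 pp.
(* The products of the statement are in X^3 and the computed series in X^6, hence the substitution
   of X^2 for X. *)
have coefE (A B : {poly int}) : A \Po 'X^2 = B -> ('X * A)`_p = B`_(2 * p.-1).
  move=> <-; rewrite coefXM coef_comp_poly_Xn // dvdn_mulr // mulKn //.
  by case: (p) p0.
have pM : (2 * p <= M)%N by rewrite leq_maxr.
have p1 : (2 * p.-1 < 2 * p)%N by lia.
have -> : a p = ser eisE (fun x => (2 * x.1 + x.2 + 1) ^+ 2 * (x.1 + 2 * x.2 + 1)) (2 * p.-1).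
  rewrite -(aP M); last by rewrite /M; lia.
  rewrite prod_qfac.
  rewrite (coefE _ (qfac 'X^6 M ^+ 8)) ?(qfac8 pM).2 //.
  by rewrite rmorphXn /= comp_qfac.
have -> : c p = ser eisE (fun x => ind3 1 (x.1 - x.2) * (x.1 - x.2)) (2 * p.-1).
  rewrite -(cP M); last by rewrite /M; lia.
  rewrite big_split /= !prod_qfac.
  rewrite (coefE _ (qfac 'X^6 M ^+ 2 * qfac 'X^18 M ^+ 2)) ?(qfac2_qfac2 pM).2 //.
  by rewrite rmorphM /= !rmorphXn /= !comp_qfac.
rewrite ser_eis_rotate; case: (ser_eis_prime pp) => [w0|[[m n] wE]].
  by rewrite w0 dvdz0.
(* The divisor is a - 2 b = - (3 n + 1), and the quotient is - (a + b) (2 a - b) with a = 2 m + n +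
   1 and b = m + 2 n + 1. *)
rewrite !wE /=; apply/dvdzP; exists (- (3 * m + 3 * n + 2) * (3 * m + 1)).
ring.
Qed.
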